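(* Let $V$ and $H$ be Hilbert spaces, let $\mathfrak{a}\colon V\times V\to\mathbb{C}$ be a continuous accretive sesquilinear form and let $j\in\mathcal{L}(V,H)$ have dense range. Let $T\in\mathcal{L}(V)$ be the operator with $\mathfrak{a}(u,v)+(j(u)\mid j(v))_H=(Tu\mid v)_V$ for all $u,v\in V$. Assume that $(\mathfrak{a},j)$ is associated with an accretive operator, and let $A$ be the operator associated with $(\mathfrak{a},j)$. Then $A$ is m-accretive if and only if \[ \operatorname{rg} j^*\subset\operatorname{rg} T . \]
   Context: Hilbert spaces are complex; inner products and sesquilinear forms are linear in the first and antilinear in the second argument. $\mathcal{L}(V,H)$ denotes the bounded linear operators from $V$ to $H$, $\mathcal{L}(V)=\mathcal{L}(V,V)$; $\operatorname{rg}$ denotes the range; $j^*\colon H\to V$ is the Hilbert space adjoint of $j$. The map $j$ is not assumed to be injective. A form $\mathfrak{a}\colon V\times V\to\mathbb{C}$ is continuous if there is $M\ge 0$ with $|\mathfrak{a}(u,v)|\le M\|u\|_V\|v\|_V$ for all $u,v\in V$, and accretive if $\operatorname{Re}\mathfrak{a}(u,u)\ge 0$ for all $u\in V$. An operator in $H$ is a linear map $A\colon D(A)\to H$ defined on a linear subspace $D(A)\subset H$ (not necessarily dense). It is accretive if $\operatorname{Re}(Ax\mid x)_H\ge 0$ for all $x\in D(A)$, and m-accretive if it is accretive and $I+A\colon D(A)\to H$ is surjective. Define $D_j(\mathfrak{a})=\{u\in V : \text{there exists } f\in H \text{ such that } \mathfrak{a}(u,v)=(f\mid j(v))_H \text{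 for all } v\in V\}$. We say that $(\mathfrak{a},j)$ is associated with an accretive operator if there exists an (accretive) operator $A$ in $H$ such that $D(A)=j(D_j(\mathfrak{a}))$ and $\mathfrak{a}(u,v)=(Aj(u)\mid j(v))_H$ for all $u\in D_j(\mathfrak{a})$ and $v\in V$; this $A$ is unique since $j(V)$ is dense, and is called the operator associated with $(\mathfrak{a},j)$. *)

(* Defs.v *)
From HB Require Import structures.
From mathcomp Require Import all_boot all_order all_algebra sesquilinear.
From mathcomp Require Import complex ring lra.
From mathcomp Require Import all_classical all_reals all_analysis.

Set Implicit Arguments.
Unset Strict Implicit.
Unset Printing Implicit Defensive.

Import Order.TTheory GRing.Theory Num.Theory.
Import numFieldNormedType.Exports.

Local Open Scope classical_set_scope.
Local Open Scope ring_scope.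
Local Open Scope complex_scope.

(* [{dot V for conj}] is linear in its first argument and antilinear in its
   second one. *)
HB.mixin Record CompleteNormedModule_isHilbert (R : realType) V
    & CompleteNormedModule R[i] V := {
  hdot : {dot V for (@Num.conj R[i])} ;
  hdot_norm : forall x : V, hdot x x = `|x| ^+ 2 }.

#[short(type="hilbertType")]
HB.structure Definition Hilbert (R : realType) :=
  { V of CompleteNormedModule R[i] V & CompleteNormedModule_isHilbert R V }.

Notation "''[' u , v ]" := (hdot u v) : ring_scope.

Section Riesz.
Variables (R : realType) (V : hilbertType R).
Implicit Types u v w : V.

Lemma Re_normE v : `|v| = (complex.Re `|v|)%:C.
Proof. by rewrite RRe_real// normr_real. Qed.

Lemma Re_norm_ge0 v : 0 <= complex.Re `|v|.
Proof. by rewrite -lecR -Re_normE normr_ge0. Qed.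

Let N v : R := complex.Re `|v|.
Let rd u v : R := complex.Re '[u, v].

Let normN v : `|v| = (N v)%:C. Proof. exact: Re_normE. Qed.

Let N_ge0 v : 0 <= N v. Proof. exact: Re_norm_ge0. Qed.

Let ReD (x y : R[i]) : complex.Re (x + y) = complex.Re x + complex.Re y.
Proof. by case: x y => ? ? []. Qed.

Let ReZ (t : R) (x : R[i]) : complex.Re (t%:C * x) = t * complex.Re x.
Proof. by case: x => a b /=; rewrite mul0r subr0. Qed.

Lemma hdotZr (a : R[i]) u v : '[u, a *: v] = Num.conj a * '[u, v].
Proof. exact: linearZr_LR. Qed.

Lemma hdotDr u v w : '[u, v + w] = '[u, v] + '[u, w].
Proof. exact: linearDr. Qed.

Let rdvv v : rd v v = N v ^+ 2.
Proof. by rewrite /rd hdot_norm normN -rmorphXn. Qed.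

Let rdC u v : rd u v = rd v u.
Proof.
rewrite /rd (hermitian_subproof u v) expr0 mul1r.
have hR (x : R[i]) : complex.Re (Num.conj x) = complex.Re x by case: x.
exact: hR.
Qed.

Let rdDl u v w : rd (u + v) w = rd u w + rd v w.
Proof. by rewrite /rd linearDl ReD. Qed.

Let rdZl t u w : rd (t%:C *: u) w = t * rd u w.
Proof. by rewrite /rd linearZl_LR ReZ. Qed.

Let rdDr u v w : rd w (u + v) = rd w u + rd w v.
Proof. by rewrite rdC rdDl !(rdC w). Qed.

Let rdZr t u w : rd w (t%:C *: u) = t * rd w u.
Proof. by rewrite rdC rdZl !(rdC w). Qed.

Let NDZ u v t : N (u + t%:C *: v) ^+ 2 = N u ^+ 2 + 2 * t * rd u v + t ^+ 2 * N v ^+ 2.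
Proof.
by rewrite -!rdvv !(rdDl, rdDr, rdZl, rdZr) (rdC v u); ring.
Qed.

Let discr (a b c : R) : 0 <= c ->
  (forall t, 0 <= a + 2 * t * b + t ^+ 2 * c) -> b ^+ 2 <= a * c.
Proof.
move=> c0 H; have [c00|cn0] := eqVneq c 0.
  have [->|b0] := eqVneq b 0; first by rewrite c00 mulr0 expr0n.
  have := H ((- a - 1) / (2 * b)).
  rewrite c00 mulr0 addr0.
  have -> : a + 2 * ((- a - 1) / (2 * b)) * b = -1 by field.
  by rewrite lerNr oppr0 ler10.
have cp : 0 < c by rewrite lt_def cn0.
have := H (- b / c).
have -> : a + 2 * (- b / c) * b + (- b / c) ^+ 2 * c = (a * c - b ^+ 2) / c by field.
by rewrite pmulr_lge0 ?invr_gt0// subr_ge0.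
Qed.

Lemma Re_hdot_le u v :
  `|complex.Re '[u, v]| <= complex.Re `|u| * complex.Re `|v|.
Proof.
rewrite -/(rd u v) -/(N u) -/(N v).
rewrite -(@ler_pXn2r _ 2)// ?nnegrE ?mulr_ge0 ?N_ge0// real_normK ?num_real//.
rewrite exprMn; apply: discr; first exact: sqr_ge0.
by move=> t; rewrite -NDZ sqr_ge0.
Qed.

Lemma riesz_real (L : V -> R) (K : R) :
  (forall u v (t : R), L (u + t%:C *: v) = L u + t * L v) ->
  (forall v, `|L v| <= K * complex.Re `|v|) ->
  exists z : V, forall v, complex.Re '[z, v] = L v.
Proof.
move=> LP LK.
pose F v := N v ^+ 2 - 2 * L v.
have FK v : - K ^+ 2 <= F v.
  have := LK v; rewrite ler_norml => /andP[_ h]; rewrite /F.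
  have := sqr_ge0 (N v - K); rewrite !expr2 in h *; nra.
pose S := range F.
have hS : has_inf S.
  split; first by exists (F 0), 0.
  by exists (- K ^+ 2) => _ [v _ <-].
pose m := inf S.
have mF v : m <= F v by apply: ge_inf; [exact: hS.2|exists v].
have Fm e : 0 < e -> exists v, F v < m + e.
  by move=> e0; have [_ [v _ <-] h] := inf_adherent e0 hS; exists v.
have FDZ u v t : F (u + t%:C *: v) = F u + 2 * t * (rd u v - L v) + t ^+ 2 * N v ^+ 2.
  by rewrite /F NDZ LP; ring.
have near_eq e u v : F u < m + e -> (rd u v - L v) ^+ 2 <= e * N v ^+ 2.
  move=> Fu; apply: discr; first exact: sqr_ge0.
  move=> t; have := mF (u + t%:C *: v); rewrite FDZ.
  by move: Fu; rewrite -/m; lra.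
have par e u v : F u < m + e -> F v < m + e -> N (u - v) ^+ 2 < 4 * e.
  move=> Fu Fv.
  have := mF (u + (2^-1)%:C *: (v - u)); rewrite FDZ.
  have : F v = F u + 2 * 1 * (rd u (v - u) - L (v - u)) + 1 ^+ 2 * N (v - u) ^+ 2.
    by rewrite -FDZ scale1r addrC subrK.
  have -> : N (u - v) = N (v - u) by rewrite /N distrC.
  by move=> h1 h2; lra.
pose G : set_system V := filter_from [set e : R | 0 < e] (fun e => [set v | F v < m + e]).
have GF : ProperFilter G.
  apply: filter_from_proper; last by move=> e /= /Fm.
  apply: filter_from_filter; first by exists 1 => /=.
  move=> a b /= a0 b0; exists (Num.min a b); first by rewrite lt_min a0.
  move=> v /= h; split; apply: (lt_le_trans h); rewrite lerD2l ge_min lexx ?orbT//.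
have Gc : cauchy G.
  apply/cauchy_ballP => e e0.
  have eE : e = (complex.Re e)%:C by rewrite RRe_real// gtr0_real.
  have r0 : 0 < complex.Re e by rewrite -ltcR -eE.
  set r := complex.Re e in eE r0.
  have d0 : 0 < r ^+ 2 / 4 by rewrite divr_gt0// exprn_gt0.
  exists ([set v | F v < m + r ^+ 2 / 4], [set v | F v < m + r ^+ 2 / 4]).
    by split; exists (r ^+ 2 / 4).
  move=> [u v] /= [Fu Fv]; rewrite -ball_normE /ball_ /= eE normN ltcR.
  rewrite -(@ltr_pXn2r _ 2)// ?nnegrE ?N_ge0 ?ltW//.
  by have := par _ _ _ Fu Fv; rewrite mulrC divfK.
have /cvg_ex[z Gz] := @cauchy_cvg _ G GF Gc.
exists z => v; apply/eqP; rewrite -subr_eq0 -normr_le0.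
apply/ler_addgt0Pr => e e0; rewrite add0r.
pose d := e / (2 * (N v + 1)).
have Nv1 : 0 < N v + 1 by rewrite ltr_wpDl.
have d0 : 0 < d by rewrite divr_gt0// mulr_gt0.
have dN : d * N v <= e / 2.
  have -> : d * N v = e / 2 * (N v / (N v + 1)).
    by rewrite /d; field; rewrite gt_eqF.
  rewrite ler_piMr ?divr_ge0 ?(ltW e0)//.
  by rewrite ler_pdivrMr// mul1r lerDl.
have [u Fu zu] : exists2 u, F u < m + d ^+ 2 & N (z - u) < d.
  have [] := @filter_ex _ G GF ([set u | F u < m + d ^+ 2] `&` [set u | N (z - u) < d]).
    apply: filterI; first by exists (d ^+ 2) => //=; rewrite exprn_gt0.
    have /cvgrPdist_lt/(_ d%:C) : id x @[x --> G] --> z by exact: Gz.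
    rewrite ltcR => /(_ d0).
    by apply: filterS => u /=; rewrite normN ltcR.
  by move=> u []; exists u.
have h1 : `|rd u v - L v| <= d * N v.
  have dN0 : 0 <= d * N v by exact: mulr_ge0 (ltW d0) (N_ge0 v).
  rewrite -(@ler_pXn2r _ 2)// real_normK ?num_real// exprMn.
  exact: near_eq.
have h2 : `|rd (z - u) v| <= d * N v.
  by apply: (le_trans (Re_hdot_le _ _)); rewrite ler_wpM2r ?N_ge0 ?(ltW zu).
have -> : rd z v - L v = rd (z - u) v + (rd u v - L v).
  by rewrite addrA -rdDl subrK.
apply: (le_trans (ler_normD _ _)); lra.
Qed.

End Riesz.

Section Adjoint.
Variables (R : realType) (V H : hilbertType R).

(* Chosen by its defining identity, which determines it uniquely; [adjointE]
   shows that such a vector exists for every bounded linear [j]. *)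
Definition adjoint (j : V -> H) (f : H) : V :=
  xget 0 [set z | forall v, '[z, v] = '[f, j v]].

Lemma adjointE (j : {linear V -> H}) : continuous j ->
  forall f v, '[adjoint j f, v] = '[f, j v].
Proof.
move=> jc f.
have ReD (x y : R[i]) : complex.Re (x + y) = complex.Re x + complex.Re y.
  by case: x y => ? ? [].
have [K [K0 jK]] : exists K : R, 0 <= K /\ forall v, `|j v| <= K%:C * `|v|.
  have /linear_boundedP/pinfty_ex_gt0[M M0 jM] :=
    (linear_bounded_continuous j).2 jc.
  have ME : M = (complex.Re M)%:C by rewrite RRe_real// gtr0_real.
  exists (complex.Re M); rewrite -ME; split => //.
  by rewrite -lecR -ME ltW.
have [z zE] : exists z : V, forall v,
    complex.Re '[z, v] = complex.Re '[f, j v].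
  apply: (@riesz_real _ _ _ (complex.Re `|f| * K)).
  - move=> u v t; rewrite linearD (linearZ_LR j) hdotDr hdotZr ReD.
    rewrite conj_Creal ?complex_real//.
    by case: ('[f, j v]) => a b /=; rewrite mul0r subr0.
  - move=> v; apply: (le_trans (Re_hdot_le _ _)); rewrite -mulrA.
    rewrite ler_wpM2l ?Re_norm_ge0//.
    by rewrite -lecR rmorphM/= -!Re_normE jK.
rewrite /adjoint; apply: (@xgetPex _ 0 [set z | forall v, '[z, v] = '[f, j v]]).
exists z => v /=; apply/eqP; rewrite eq_complex zE eqxx/=; apply/eqP.
have := zE ('i *: v); rewrite (linearZ_LR j) !hdotZr.
move: (hdot _ _) (hdot _ _) => [a b] [c d] /=.
by rewrite !mul0r !sub0r !mulN1r !opprK.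
Qed.

End Adjoint.

Section Operators.
Variables (R : realType) (H : hilbertType R).

(* A possibly unbounded, possibly not densely defined operator.  The values of
   [op_fun] outside [op_dom] are irrelevant: nothing is assumed about them and
   no definition below depends on them. *)
Record operator := Operator {
  op_dom : set H ;
  op_fun :> H -> H ;
  op_dom0 : op_dom 0 ;
  op_domP : forall (c : R[i]) x y,
    op_dom x -> op_dom y -> op_dom (c *: x + y) ;
  op_funP : forall (c : R[i]) x y,
    op_dom x -> op_dom y -> op_fun (c *: x + y) = c *: op_fun x + op_fun y }.

Definition op_accretive (A : operator) :=
  forall x, op_dom A x -> 0 <= complex.Re '[A x, x].

Definition m_accretive (A : operator) :=
  op_accretive A /\ forall y, exists2 x, op_dom A x & x + A x = y.

End Operators.

Section Forms.
Variables (R : realType) (V H : hilbertType R).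
Implicit Types (a : V -> V -> R[i]) (j : V -> H) (A : operator H).

Definition form_continuous a :=
  exists2 M : R, 0 <= M & forall u v, `|a u v| <= M%:C * `|u| * `|v|.

Definition form_accretive a := forall u, 0 <= complex.Re (a u u).

Definition form_dom a j : set V :=
  [set u | exists f : H, forall v, a u v = '[f, j v]].

Definition is_associated_operator a j A :=
  op_dom A = j @` form_dom a j /\
  forall u, form_dom a j u -> forall v, a u v = '[A (j u), j v].

Definition associated_with_accretive_operator a j :=
  exists2 A, op_accretive A & is_associated_operator a j A.

End Forms.

(* Main.v *)
(* For u in V, the equation T u = j^* f says exactly that u lies in D_j(a) and
   j(u) + A j(u) = f; the density of rg j is what identifies A j(u) with
   f - j(u). *)
Require Import Defs.
From HB Require Import structures.
From mathcomp Require Import all_boot all_order all_algebra sesquilinear.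
From mathcomp Require Import complex.
From mathcomp Require Import all_classical all_reals all_analysis.

Set Implicit Arguments.
Unset Strict Implicit.
Unset Printing Implicit Defensive.

Import Order.TTheory GRing.Theory Num.Theory.
Import numFieldNormedType.Exports.

Local Open Scope classical_set_scope.
Local Open Scope ring_scope.
Local Open Scope complex_scope.

(** Tested against [v], the equation [T u = adjoint j f] reads [a u v = '[f - j u, j v]]. If [A] is
    m-accretive, writing the solution of [x + A x = f] as [x = j u] with [u] in [form_dom a j] gives
    such a [u]. Conversely, such a [u] lies in [form_dom a j], and [dense_hdot_eq0] forces
    [A (j u) = f - j u]. *)

Lemma hdot_injl (R : realType) (V : hilbertType R) (x y : V) :
  (forall v, '[x, v] = '[y, v]) -> x = y.
Proof.
move=> xy; apply/eqP; rewrite -subr_eq0 -normr_eq0 -sqrf_eq0 -hdot_norm.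
by rewrite linearBl /= xy subrr.
Qed.

(** If [w] is nonzero, some [x] in [S] has [|w - x| < |w|]; orthogonality and Cauchy-Schwarz then
    give [|w|^2 = Re '[w, w - x] <= |w| |w - x| < |w|^2]. *)
Lemma dense_hdot_eq0 (R : realType) (H : hilbertType R) (S : set H) (w : H) :
  dense S -> (forall x, S x -> '[w, x] = 0) -> w = 0.
Proof.
move=> Sd w0; apply/eqP; apply: contraT => wn0.
have [x [wx Sx]] : ball w `|w| `&` S !=set0.
  apply: Sd; last exact: ball_open.
  by exists w; apply: ballxx; rewrite normr_gt0.
move: wx; rewrite -ball_normE /ball_ /= (Re_normE w) (Re_normE (w - x)) ltcR => wx.
have := Re_hdot_le w (w - x).
rewrite linearBr /= (w0 x Sx) subr0 hdot_norm (Re_normE w) -rmorphXn /= expr2.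
rewrite ger0_norm ?mulr_ge0 ?Re_norm_ge0// leNgt ltr_pM2l ?wx//.
by rewrite -ltcR -Re_normE normr_gt0.
Qed.

Theorem theorem4p2 (R : realType) (V H : hilbertType R)
    (a : {bilinear V -> V -> R[i] | *%R & (@Num.conj R[i]) \; *%R})
    (j : {linear V -> H}) (T : {linear V -> V}) (A : operator H)
    (a_cont : form_continuous a) (a_accr : form_accretive a)
    (j_cont : continuous j) (j_dense : dense (range j))
    (T_cont : continuous T)
    (TE : forall u v : V, a u v + '[j u, j v] = '[T u, v])
    (a_assoc : associated_with_accretive_operator a j)
    (A_assoc : is_associated_operator a j A) :
  m_accretive A <-> range (adjoint j) `<=` range T.
Proof.
have [domA AE] := A_assoc; split.
  move=> [_ A_surj] _ [f _ <-].
  have [x] := A_surj f; rewrite domA => -[u uD <-] juA.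
  exists u => //; apply: hdot_injl => v.
  by rewrite -TE AE// adjointE// -juA linearDl addrC.
move=> jT; split.
  (* Accretivity is inherited from the form: ['[A (j u), j u] = a u u]. *)
  by move=> x; rewrite domA => -[u uD <-]; rewrite -AE.
move=> f; have [u _ Tu] := jT _ (imageT (adjoint j) f).
have auE v : a u v = '[f - j u, j v].
  by apply: (addIr '[j u, j v]); rewrite TE Tu adjointE// linearBl /= subrK.
have uD : form_dom a j u by exists (f - j u).
exists (j u); first by rewrite domA; exists u.
(* Both sides represent [a u] against the dense range of [j]. *)
suff -> : A (j u) = f - j u by rewrite addrC subrK.
apply/eqP; rewrite -subr_eq0; apply/eqP; apply: dense_hdot_eq0 j_dense _.
by move=> _ [v _ <-]; rewrite linearBl /= -AE// auE subrr.
Qed.
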